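(* The set $\{h(E(S)) : S\in\mathbf{G}\}$ has countably many gaps.
   Context: Let $\mathbf{G}$ be the set of all finite or infinite (strictly) increasing sequences of positive integers beginning with $1$; a sequence is identified with the set of its terms. For $S\in\mathbf{G}$, a positive integer $N$ is called an exponentially $S$-number, written $N\in E(S)$, if all exponents in its prime power factorization belong to $S$ (so $1\in E(S)$ vacuously). For every $S\in\mathbf{G}$, $h(E(S))$ denotes the natural density of $E(S)$, i.e. $h(E(S))=\lim_{x\to\infty}\frac1x\#\{i\le x: i\in E(S)\}$. It is known from earlier work that this density exists, lies in $[\frac{6}{\pi^2},1]$, and equals $$h(E(S))=\prod_{p}\Bigl(1+\sum_{i\ge2}\frac{u(i)-u(i-1)}{p^i}\Bigr),$$ where $p$ runs over all primes and $u$ is the characteristic function of $S$ ($u(n)=1$ if $n\in S$, $u(n)=0$ otherwise). A gap in $\{h(E(S)) : S\in\mathbf{G}\}$ is a nonempty open interval contained in $[\frac{6}{\pi^2},1]$ that contains no point of this set and is maximal (with respect to inclusion) with this property. *)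

(* Defs.v *)
From mathcomp Require Import all_boot all_order all_algebra.
From mathcomp Require Import all_classical all_reals all_analysis.

Set Implicit Arguments.
Unset Strict Implicit.
Unset Printing Implicit Defensive.

Import Order.TTheory GRing.Theory Num.Theory.
Import numFieldNormedType.Exports.

Local Open Scope classical_set_scope.
Local Open Scope ring_scope.

(* A finite or infinite strictly increasing sequence of positive integers
   beginning with 1 is represented by the set of its terms. *)
Definition bigG : set (set nat) :=
  [set S | (exists2 s : seq nat, path ltn 1%N s & S = [set` 1%N :: s])
        \/ (exists s : nat -> nat,
              [/\ s 0%N = 1%N, {homo s : i j / (i < j)%N} & S = range s])].

Definition exp_numbers (S : set nat) : set nat :=
  [set N | (0 < N)%N /\
           forall p : nat, prime p -> (p %| N)%N -> S (logn p N)].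

(* [iota 1 (Num.truncn x)] lists the positive integers [i <= x]. *)
Definition has_natural_density (R : realType) (A : set nat) (d : R) : Prop :=
  (count (fun i => i \in A) (iota 1 (Num.truncn x)))%:R / x
    @[x --> +oo] --> d.

Definition densities (R : realType) : set R :=
  [set d | exists2 S : set nat, bigG S & has_natural_density (exp_numbers S) d].
Arguments densities R : clear implicits.

Definition density_free_interval (R : realType) (I : set R) : Prop :=
  [/\ exists2 ab : R * R, ab.1 < ab.2 & I = `]ab.1, ab.2[%classic,
      I `<=` `[6 / pi ^+ 2, 1]%classic
    & I `&` densities R = set0].

Definition gaps (R : realType) : set (set R) :=
  [set I | density_free_interval I /\
           forall J : set R, density_free_interval J -> I `<=` J -> J = I].
Arguments gaps R : clear implicits.

(* Main.v *)
Require Import Defs.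
From mathcomp Require Import all_boot all_order all_algebra.
From mathcomp Require Import all_classical all_reals all_analysis.
From mathcomp Require Import zify ring lra.

(** Gaps are pairwise disjoint nonempty open intervals (two that meet have a
    density-free union, so maximality makes them equal), and each contains a
    rational: there are countably many ([countable_gaps]).

    For infinitely many gaps, fix [k >= 4] and compare two kinds of sets [S].
    - If [S] misses some [j <= k], then no exponentially [S]-number has
      exponent exactly [j] at the prime 2 or at the prime 3.  Inclusion and
      exclusion over these two primes alone bounds the density above by
      1 - 2^-(k+1) - 2 * 3^-(k+1) + 6^-k ([avoid_density_le], [avoid_bound_le]).
    - If [S] contains 1, ..., k, then every (k+1)-free number is an
      exponentially [S]-number, and the union bound over p^(k+1) gives a
      density at least 1 - 2^-(k+1) - 3^-(k+1) - (sum of p^-(k+1), p >= 5)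
      ([full_density_ge]).
    The main terms 2^-(k+1) agree, and the second bound wins because of the
    prime 3: the first case loses 2 * 3^-(k+1), twice the amount lost in the
    second, and everything else is of smaller order ([avoid_lt_full]).  So the
    interval between the two bounds contains no density.  It also lies above
    6 / pi^2, for which the estimate pi^2 >= 8 suffices ([pi_sqr_ge8]).

    Every density-free interval extends to a gap ([sub_gap]).  The gaps so
    obtained for different [k] are different because the density of the
    (k+1)-free numbers lies between two consecutive intervals
    ([density_between_holes]).  That this density exists is shown by a sieve
    ([free_density_exists]): forbidding p^(k+1) for p <= y only gives a
    periodic set, and the numbers that this overlooks are at most N / y among
    the first N. *)

Set Implicit Arguments.
Unset Strict Implicit.
Unset Printing Implicit Defensive.

Import Order.TTheory GRing.Theory Num.Theory.
Import numFieldNormedType.Exports.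

Local Open Scope classical_set_scope.
Local Open Scope ring_scope.

(** * Natural density from linear bounds on the counting function *)

Definition counting (A : set nat) (N : nat) : nat :=
  count (fun i => i \in A) (iota 1 N).

Section Density.
Variable R : realType.
Implicit Types (A : set nat) (C d e : R).

(** For large [x], the term [e * x] absorbs [C] and the effect of replacing [x]
    by its integer part, which is at most [`|a|]. *)
Lemma counting_ratio_le A a C e : 0 < e ->
  (forall N, (counting A N)%:R <= a * N%:R + C) ->
  \forall x \near +oo, (counting A (Num.truncn x))%:R / x <= a + e.
Proof.
move=> e0 bnd; near=> x.
have x1 : 1 <= x by near: x; apply: nbhs_pinfty_ge; rewrite num_real.
have xC : (`|a| + `|C|) / e <= x by near: x; apply: nbhs_pinfty_ge; rewrite num_real.
have x0 : 0 < x by lra.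
rewrite ler_pdivrMr // (le_trans (bnd _)) //.
have /andP[t1 t2] := truncn_itv (ltW x0); rewrite -natr1 in t2.
rewrite ler_pdivrMr // in xC.
have aC := ler_norm C.
have := ler_norm (a * ((Num.truncn x)%:R - x)).
rewrite normrM => h.
have /(ler_wpM2l (normr_ge0 a)) : `|(Num.truncn x)%:R - x| <= 1.
  by rewrite ler_norml; lra.
lra.
Unshelve. all: by end_near. Qed.

Lemma counting_ratio_ge A a C e : 0 < e ->
  (forall N, a * N%:R - C <= (counting A N)%:R) ->
  \forall x \near +oo, a - e <= (counting A (Num.truncn x))%:R / x.
Proof.
move=> e0 bnd; near=> x.
have x1 : 1 <= x by near: x; apply: nbhs_pinfty_ge; rewrite num_real.
have xC : (`|a| + `|C|) / e <= x by near: x; apply: nbhs_pinfty_ge; rewrite num_real.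
have x0 : 0 < x by lra.
rewrite ler_pdivlMr //; apply: le_trans (bnd _).
have /andP[t1 t2] := truncn_itv (ltW x0); rewrite -natr1 in t2.
rewrite ler_pdivrMr // in xC.
have aC := ler_norm C.
have := ler_norm (a * (x - (Num.truncn x)%:R)).
rewrite normrM => h.
have /(ler_wpM2l (normr_ge0 a)) : `|x - (Num.truncn x)%:R| <= 1.
  by rewrite ler_norml; lra.
lra.
Unshelve. all: by end_near. Qed.

Lemma density_le A a C d : has_natural_density A d ->
  (forall N, (counting A N)%:R <= a * N%:R + C) -> d <= a.
Proof.
move=> Ad bnd; apply/ler_addgt0Pr => e e0.
exact: cvgr_to_le Ad (counting_ratio_le e0 bnd).
Qed.

Lemma density_ge A a C d : has_natural_density A d ->
  (forall N, a * N%:R - C <= (counting A N)%:R) -> a <= d.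
Proof.
move=> Ad bnd; apply/ler_addgt0Pr => e e0; rewrite -lerBlDr.
exact: cvgr_to_ge Ad (counting_ratio_ge e0 bnd).
Qed.

(** A completeness criterion.  The limit is the infimum of all slopes [a] for
    which [a * N + C] bounds the counting function above; a slope that is also
    a lower bound up to [e] is then within [e] of this infimum. *)
Lemma density_exists A :
  (forall e, 0 < e -> exists a C, forall N,
     (a - e) * N%:R - C <= (counting A N)%:R <= a * N%:R + C) ->
  exists d : R, has_natural_density A d.
Proof.
move=> approx.
pose D := [set a | exists C, forall N, (counting A N)%:R <= a * N%:R + C : Prop].
(* Comparing the two bounds at one [N] large with respect to [C + C']. *)
have lbD a b C : D b ->
    (forall N, a * N%:R - C <= (counting A N)%:R) -> a <= b.
  move=> [C' ub] lb; apply/ler_addgt0Pr => e e0.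
  pose N := (Num.truncn ((C + C') / e)).+1.
  have := truncnS_gt ((C + C') / e); rewrite -/N ltr_pdivrMr // => NC.
  have /le_trans/(_ (ub N)) := lb N => H.
  have N0 : (0 : R) < N%:R by rewrite ltr0n.
  rewrite -(ler_pM2r N0); lra.
have infD e a C : (forall N, (a - e) * N%:R - C <= (counting A N)%:R) ->
    (forall N, (counting A N)%:R <= a * N%:R + C) ->
    a - e <= inf D /\ inf D <= a.
  move=> lb ub; have Da : D a by exists C.
  have lbDae : lbound D (a - e) by move=> b Db; exact: lbD lb.
  split; first by apply: lb_le_inf => //; exists a.
  by apply: ge_inf => //; exists (a - e).
exists (inf D); apply/cvgrPdist_le => e e0.
have e20 : 0 < e / 2 by lra.
have [a [C bnd]] := approx _ e20.
have lb N : (a - e / 2) * N%:R - C <= (counting A N)%:R by case/andP: (bnd N).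
have ub N : (counting A N)%:R <= a * N%:R + C by case/andP: (bnd N).
have [d1 d2] := infD _ _ _ lb ub.
near=> x; rewrite ler_norml.
have h1 : a - e / 2 - e / 2 <= (counting A (Num.truncn x))%:R / x.
  by near: x; exact: counting_ratio_ge lb.
have h2 : (counting A (Num.truncn x))%:R / x <= a + e / 2.
  by near: x; exact: counting_ratio_le ub.
rewrite /counting in h1 h2.
by apply/andP; split; lra.
Unshelve. all: by end_near. Qed.

End Density.

(** * Sieving out high prime powers *)

Lemma countingE A N : counting A N = (\sum_(1 <= i < N.+1) (i \in A))%N.
Proof.
rewrite /counting -sum1_count big_mkcond /= /index_iota subSS subn0.
by apply: eq_bigr => i _; case: (i \in A).
Qed.

Lemma natr_divn_bounds (R : realType) d N : (0 < d)%N ->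
  N%:R / d%:R - 1 <= ((N %/ d)%:R : R) <= N%:R / d%:R.
Proof.
move=> d0; have dR : (0 : R) < d%:R by rewrite ltr0n.
have e : N%:R = (N %/ d)%:R * d%:R + (N %% d)%:R :> R.
  by rewrite -natrM -natrD -divn_eq.
have l : (N %% d)%:R <= d%:R :> R by rewrite ler_nat ltnW // ltn_mod.
rewrite lerBlDr ler_pdivrMr // ler_pdivlMr // mulrDl mul1r.
have r0 : (0 : R) <= (N %% d)%:R by [].
by apply/andP; split; lra.
Qed.

(** The periodic approximation to the [m]-free numbers that tests only the
    primes up to [y]. *)
Definition sifted (m y : nat) : set nat :=
  [set i | forall p, prime p -> (p <= y)%N -> ~~ (p ^ m %| i)%N].

Lemma free_sub_exp_numbers (S : set nat) m i :
  (forall j, (0 < j < m)%N -> S j) -> (0 < i)%N ->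
  (forall p, prime p -> ~~ (p ^ m %| i)%N) -> exp_numbers S i.
Proof.
move=> Sm i0 free; split=> // p pp pi; apply: Sm.
rewrite logn_gt0 mem_primes pp i0 pi /= ltnNge.
by rewrite -(pfactor_dvdn m pp i0) free.
Qed.

(** A sifted number outside E(S) is divisible by [p ^ m] for a prime [p > y],
    since all exponents below [m] are allowed; the sum counts the multiples of
    [p ^ m], over all integers [p > y] for simplicity. *)
Lemma counting_sifted_le (S : set nat) m y N :
  (forall j, (0 < j < m)%N -> S j) -> (0 < m)%N ->
  (counting (sifted m y) N <=
   counting (exp_numbers S) N + \sum_(y.+1 <= p < N.+1) N %/ p ^ m)%N.
Proof.
move=> Sm m0; rewrite !countingE.
under [X in (_ + X)%N]eq_bigr do rewrite divn_count_dvd.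
rewrite exchange_big /= -big_split /= !big_nat; apply: leq_sum => i /andP[i0 iN].
case: (boolP (i \in sifted m y)) => //; rewrite inE /sifted /= => sift.
case: (boolP (i \in exp_numbers S)) => //; rewrite notin_setE => notS.
rewrite add0n lt0n; apply: contra_notN notS => /eqP no_big.
apply: (free_sub_exp_numbers Sm i0) => p pp.
case: (leqP p y) => [|yp]; first exact: sift.
apply/negP => pmi; have pi : (p %| i)%N by rewrite (dvdn_trans _ pmi) ?dvdn_exp.
have pN : (p < N.+1)%N by rewrite (leq_ltn_trans (dvdn_leq i0 pi)).
move: no_big; rewrite (bigD1_seq p) ?iota_uniq ?mem_index_iota ?yp //=.
by rewrite pmi.
Qed.

(** All but two of the factors [1 / p] are bounded by [1 / y.+1]; the remaining
    [1 / p ^ 2] is below [1 / (p - 1) - 1 / p], which telescopes. *)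
Lemma sum_inv_pow_le (R : realType) n y N : (0 < y)%N ->
  \sum_(y.+1 <= p < N.+1) (p%:R^-1 : R) ^+ n.+2
    <= (y.+1%:R^-1) ^+ n / y%:R.
Proof.
move=> y0; have y1 : (0 : R) < y%:R by rewrite ltr0n.
have c0 : (0 : R) <= y.+1%:R^-1 ^+ n by rewrite exprn_ge0 // invr_ge0.
have [Ny|yN] := ltnP N y.
  by rewrite big_geq ?divr_ge0 // ltnS ltnW.
suff : \sum_(y.+1 <= p < N.+1) (p%:R^-1 : R) ^+ n.+2
    <= (y.+1%:R^-1) ^+ n * (y%:R^-1 - N%:R^-1).
  move=> /le_trans; apply; rewrite ler_wpM2l // gerBl invr_ge0.
  exact: ler0n.
elim: N yN => [|N IH yN]; first by rewrite leqNgt y0.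
move: yN; rewrite leq_eqVlt => /predU1P[->|]; first by rewrite big_geq // subrr mulr0.
rewrite ltnS => yN.
rewrite big_nat_recr //=.
have N0 : (0 : R) < N%:R by rewrite ltr0n; lia.
have N10 : (0 : R) < N.+1%:R by rewrite ltr0n.
apply: (@le_trans _ _ (y.+1%:R^-1 ^+ n * (y%:R^-1 - N%:R^-1)
   + y.+1%:R^-1 ^+ n * (N%:R^-1 - N.+1%:R^-1))); last first.
  by rewrite -mulrDr addrA subrK.
apply: lerD; first exact: IH.
rewrite -addn2 exprD; apply: ler_pM.
- by rewrite exprn_ge0 // invr_ge0 ltW.
- by rewrite exprn_ge0 // invr_ge0 ltW.
- rewrite lerXn2r ?nnegrE ?invr_ge0 ?ler0n // lef_pV2 ?posrE ?ltr0n //.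
  by rewrite ler_nat; lia.
have -> : N%:R^-1 - N.+1%:R^-1 = N%:R^-1 * N.+1%:R^-1 :> R.
  rewrite -natr1; field; rewrite natr1.
  by rewrite !gt_eqF.
rewrite expr2 ler_wpM2r ?invr_ge0 ?ltW // ltf_pV2 ?posrE //.
by rewrite ltr_nat.
Qed.

Lemma tail_multiples_le (R : realType) n y N : (0 < y)%N ->
  (\sum_(y.+1 <= p < N.+1) N %/ p ^ n.+2)%N%:R
    <= N%:R * ((y.+1%:R^-1) ^+ n / y%:R) :> R.
Proof.
move=> y0; rewrite natr_sum.
apply: le_trans (ler_wpM2l (ler0n _ _) (sum_inv_pow_le R n N y0)).
rewrite mulr_sumr !big_nat; apply: ler_sum => p /andP[yp _].
have p0 : (0 < p ^ n.+2)%N by rewrite expn_gt0; lia.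
have /andP[_] := natr_divn_bounds R N p0.
by rewrite natrX exprVn.
Qed.

Lemma counting_periodic (A : set nat) (Q N : nat) :
  (forall i, (0 < i)%N -> (i + Q \in A) = (i \in A)) ->
  counting A (N + Q) = (counting A N + counting A Q)%N.
Proof.
move=> per; rewrite /counting addnC iotaD count_cat addnC; congr addn.
rewrite addnC iotaDl count_map; apply: eq_in_count => i.
by rewrite mem_iota /= => /andP[i0 _]; rewrite addnC per.
Qed.

Lemma counting_le A N : (counting A N <= N)%N.
Proof. by rewrite (leq_trans (count_size _ _)) // size_iota. Qed.

Lemma periodic_counting_bounds (R : realType) (A : set nat) (Q : nat) :
  (0 < Q)%N -> (forall i, (0 < i)%N -> (i + Q \in A) = (i \in A)) ->
  exists a : R, forall N,
    a * N%:R - Q%:R <= (counting A N)%:R <= a * N%:R + Q%:R.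
Proof.
move=> Q0 per; pose a : R := (counting A Q)%:R / Q%:R; exists a => N.
have QR : (0 : R) < Q%:R by rewrite ltr0n.
have cM q r : counting A (q * Q + r) = (q * counting A Q + counting A r)%N.
  elim: q => [|q IH]; first by rewrite mul0n.
  have -> : (q.+1 * Q + r = q * Q + r + Q)%N by lia.
  by rewrite counting_periodic // IH; lia.
have aQ : a * Q%:R = (counting A Q)%:R by rewrite /a divfK // gt_eqF.
have a0 : 0 <= a by rewrite divr_ge0.
have a1 : a <= 1 by rewrite ler_pdivrMr // mul1r ler_nat counting_le.
have rQ : (N %% Q)%:R <= Q%:R :> R by rewrite ler_nat ltnW // ltn_mod.
have r0 : (0 : R) <= (N %% Q)%:R by [].
have cr : (counting A (N %% Q))%:R <= Q%:R :> R.
  by rewrite (le_trans _ rQ) // ler_nat counting_le.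
have cr0 : (0 : R) <= (counting A (N %% Q))%:R by [].
rewrite [in counting A N](divn_eq N Q) [in a * N%:R](divn_eq N Q) cM.
rewrite !natrD !natrM mulrDr mulrCA aQ.
have h1 : a * (N %% Q)%:R <= 1 * Q%:R by rewrite ler_pM.
have h2 : 0 <= a * (N %% Q)%:R by rewrite mulr_ge0.
by apply/andP; split; lra.
Qed.

Lemma sifted_periodic (m y i : nat) :
  (i + (y`! ^ m)%N \in sifted m y) = (i \in sifted m y).
Proof.
rewrite /sifted; apply/idP/idP; rewrite !inE => sift p pp py;
  have pQ : (p ^ m %| (y`! ^ m)%N)%N
    by rewrite dvdn_exp2r // dvdn_fact // prime_gt0.
- by move: (sift p pp py); rewrite dvdn_addl.
- by rewrite dvdn_addl // sift.
Qed.

Lemma leq_counting (A B : set nat) N : A `<=` B -> (counting A N <= counting B N)%N.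
Proof. by move=> AB; apply: sub_count => i; rewrite !inE; exact: AB. Qed.

Definition exponents_below (m : nat) : set nat := [set j | (0 < j < m)%N].

Lemma exp_numbers_sub_sifted m y : (0 < m)%N ->
  exp_numbers (exponents_below m) `<=` sifted m y.
Proof.
move=> m0 i [i0 expi] p pp _; rewrite (pfactor_dvdn m pp i0) -ltnNge.
case: (posnP (logn p i)) => [->//|].
rewrite logn_gt0 mem_primes => /and3P[_ _ pi].
by have /andP[] := expi p pp pi.
Qed.

(** With [y] at least [1 / e], the periodic set of numbers sifted up to [y]
    counts the [n.+2]-free numbers with an error of at most [e * N]. *)
Lemma free_density_exists (R : realType) n :
  exists d : R, has_natural_density (exp_numbers (exponents_below n.+2)) d.
Proof.
apply: density_exists => e e0.
pose y := (Num.truncn e^-1).+1.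
have ye : y%:R^-1 <= e.
  by rewrite invf_ple ?posrE ?ltr0n // ltW // truncnS_gt.
have Q0 : (0 < y`! ^ n.+2)%N by rewrite expn_gt0 fact_gt0.
have [a bnd] := periodic_counting_bounds R Q0 (fun i _ => sifted_periodic n.+2 y i).
exists a, (y`! ^ n.+2)%N%:R => N; have /andP[lb ub] := bnd N.
apply/andP; split; last first.
  apply: le_trans ub; rewrite ler_nat leq_counting //.
  exact: exp_numbers_sub_sifted.
have : (counting (sifted n.+2 y) N)%:R <=
    (counting (exp_numbers (exponents_below n.+2)) N)%:R
      + (\sum_(y.+1 <= p < N.+1) N %/ p ^ n.+2)%N%:R :> R.
  by rewrite -natrD ler_nat counting_sifted_le.
have := tail_multiples_le R n N (isT : (0 < y)%N).
have : N%:R * (y.+1%:R^-1 ^+ n / y%:R) <= N%:R * e.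
  rewrite ler_wpM2l //; apply: le_trans ye.
  rewrite ler_piMl ?invr_ge0 // exprn_ile1 ?invr_ge0 //.
  by rewrite invf_le1 ?ltr0n // ler1n.
lra.
Qed.

(** * Two bounds on the density of E(S) *)

(** Lower bound for the density when [S] contains 1, ..., n.+1.  The last term
    bounds the sum of [p ^- n.+2] over [p >= 5]. *)
Definition full_bound (R : realType) (n : nat) : R :=
  1 - 2%:R^-1 ^+ n.+2 - 3%:R^-1 ^+ n.+2 - 5%:R^-1 ^+ n / 4.

(** Upper bound for the density when [S] misses [k]: the exponent at [p] is
    exactly [k] with density [p^-k - p^-(k+1)], that is 2^-(k+1) for [p = 2] and
    2 * 3^-(k+1) for [p = 3], and [6^-k] dominates the overlap. *)
Definition avoid_bound (R : realType) (k : nat) : R :=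
  1 - 2%:R^-1 ^+ k.+1 - 2 * 3%:R^-1 ^+ k.+1 + 6%:R^-1 ^+ k.

(** The primes 2 and 3 are counted exactly and the sieve handles the primes
    above 4; bounding 3 together with the tail would be too lossy for
    [avoid_lt_full]. *)
Lemma full_density_ge (R : realType) (S : set nat) n (d : R) :
  (forall j, (0 < j < n.+2)%N -> S j) ->
  has_natural_density (exp_numbers S) d -> full_bound R n <= d.
Proof.
move=> fullS Sd; apply: (@density_ge _ _ _ 0 _ Sd) => N.
have sieve := counting_sifted_le 4 N fullS (isT : (0 < n.+2)%N).
have : (N <= counting (sifted n.+2 4) N + N %/ 2 ^ n.+2 + N %/ 3 ^ n.+2)%N.
  rewrite countingE !divn_count_dvd -!big_split /= -{1}[N]subn0 -subSS.
  rewrite -[leqLHS]muln1 -sum_nat_const_nat !big_nat.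
  apply: leq_sum => i _; rewrite -addnA.
  case: (boolP (i \in sifted n.+2 4)) => //; rewrite notin_setE add0n lt0n => nsift.
  apply: contra_notN nsift => /eqP no23 p.
  (* Only [p = 2] and [p = 3] are primes up to 4. *)
  case: p => [|[|[|[|[|p]]]]] //= _ _; apply/negP => dvd; move: no23; rewrite dvd //.
  by rewrite addn1.
rewrite -(ler_nat R) !natrD => bound23.
have tail := tail_multiples_le R n N (isT : (0 < 4)%N).
have sieveR : (counting (sifted n.+2 4) N)%:R <= (counting (exp_numbers S) N)%:R
    + (\sum_(5 <= p < N.+1) N %/ p ^ n.+2)%N%:R :> R by rewrite -natrD ler_nat.
have /andP[_] := natr_divn_bounds R N (expn_gt0 2 n.+2 : (0 < 2 ^ n.+2)%N).
have /andP[_] := natr_divn_bounds R N (expn_gt0 3 n.+2 : (0 < 3 ^ n.+2)%N).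
rewrite !natrX -!exprVn /full_bound; lra.
Qed.

(** The inequality holds for each [i <= N] separately.  If [i] is in E(S), then
    divisibility by [p ^ k] forces divisibility by [p ^ k.+1], so the terms for
    [p] and for [q] cancel.  If not, it says that two indicators exceed 1 by at
    most their product. *)
Lemma counting_avoid_le (S : set nat) k p q N :
  prime p -> prime q -> p != q -> (0 < k)%N -> ~ S k ->
  (counting (exp_numbers S) N + N %/ p ^ k + N %/ q ^ k
    <= N + N %/ p ^ k.+1 + N %/ q ^ k.+1 + N %/ (p * q) ^ k)%N.
Proof.
move=> pp qp pq k0 Sk.
rewrite countingE !divn_count_dvd -[X in (X + _ + _ + _)%N]muln1.
rewrite -{4}[N]subn0 -subSS -sum_nat_const_nat -!big_split /= !big_nat.
apply: leq_sum => i /andP[i0 _].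
have coprime_pq : coprime (p ^ k) (q ^ k).
  by rewrite coprimeXl // coprimeXr // prime_coprime // dvdn_prime2.
rewrite expnMn Gauss_dvd //.
have [|_] := boolP (i \in exp_numbers S); last by do 2 case: (_ %| i)%N; lia.
rewrite inE => -[_ expi].
have same r : prime r -> (r ^ k.+1 %| i)%N = (r ^ k %| i)%N.
  move=> rp; rewrite !pfactor_dvdn // [RHS]leq_eqVlt; case: eqP => //= kr; exfalso.
  apply: Sk; rewrite kr; apply: expi => //.
  by move: k0; rewrite kr logn_gt0 mem_primes => /and3P[].
by rewrite !same //; lia.
Qed.

Lemma avoid_density_le (R : realType) (S : set nat) k (d : R) :
  (0 < k)%N -> ~ S k -> has_natural_density (exp_numbers S) d ->
  d <= avoid_bound R k.
Proof.
move=> k0 Sk Sd; apply: (@density_le _ _ _ 2 _ Sd) => N.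
have := counting_avoid_le N (isT : prime 2) (isT : prime 3) isT k0 Sk.
rewrite -(ler_nat R) !natrD.
have /andP[+ _] := natr_divn_bounds R N (expn_gt0 2 k : (0 < 2 ^ k)%N).
have /andP[+ _] := natr_divn_bounds R N (expn_gt0 3 k : (0 < 3 ^ k)%N).
have /andP[_ +] := natr_divn_bounds R N (expn_gt0 2 k.+1 : (0 < 2 ^ k.+1)%N).
have /andP[_ +] := natr_divn_bounds R N (expn_gt0 3 k.+1 : (0 < 3 ^ k.+1)%N).
have /andP[_ +] := natr_divn_bounds R N (expn_gt0 6 k : (0 < 6 ^ k)%N).
rewrite !natrX -!exprVn /avoid_bound !exprS; lra.
Qed.

Lemma avoid_bound_le (R : realType) j k : (0 < j <= k)%N ->
  avoid_bound R j <= avoid_bound R k.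
Proof.
case/andP=> j0; elim: k => [|k IH]; first by rewrite leqNgt j0.
rewrite leq_eqVlt => /predU1P[->//|]; rewrite ltnS => jk.
apply: le_trans (IH jk) _; have : (0 < k)%N by lia.
case: k {IH jk} => // k _; rewrite /avoid_bound !exprS.
have a0 : (0 : R) <= 2^-1 ^+ k by rewrite exprn_ge0.
have b0 : (0 : R) <= 3^-1 ^+ k by rewrite exprn_ge0.
have : (6^-1 ^+ k : R) <= 3^-1 ^+ k.
  by rewrite lerXn2r ?nnegrE //; lra.
lra.
Qed.

(** After cancellation, [3 ^- n.+2] has to exceed [5 ^- n / 4 + 6 ^- n.+1]; this
    is true at [n = 3], and each step divides the first quantity by 3 but the
    second by at least 5. *)
Lemma avoid_lt_full (R : realType) n : (3 <= n)%N ->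
  avoid_bound R n.+1 < full_bound R n.
Proof.
move=> n3; rewrite /avoid_bound /full_bound.
suff : 5^-1 ^+ n / 4 + 6^-1 ^+ n.+1 < 3^-1 ^+ n.+2 :> R by lra.
rewrite -(subnK n3); elim: (n - 3)%N => [|i IH]; first by rewrite !exprS !expr0; lra.
have a0 : (0 : R) <= 5^-1 ^+ (i + 3) by rewrite exprn_ge0.
have b0 : (0 : R) <= 6^-1 ^+ (i + 3) by rewrite exprn_ge0.
by move: IH; rewrite addSn !exprS; lra.
Qed.

(** * Comparison with 6 / pi^2 *)

Lemma sin_le_id (R : realType) (x : R) : 0 <= x -> sin x <= x.
Proof.
move=> x0.
have [|c _] := MVT_segment x0 (fun y _ => is_derive_sin y).
  by apply: continuous_subspaceT => y; exact: continuous_sin.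
rewrite sin0 !subr0 => ->; rewrite ler_piMl //; exact: cos_le1.
Qed.

(** From sin (pi / 4) <= pi / 4, as sin (pi / 4) squared is 1 / 2. *)
Lemma pi_sqr_ge8 (R : realType) : 8 <= pi ^+ 2 :> R.
Proof.
have p0 : (0 : R) < pi / 4 by rewrite divr_gt0 // pi_gt0.
have s0 : 0 <= sin (pi / 4 : R).
  by apply: sin_ge0_pi; have := pi_gt0 R; lra.
have := sin_le_id (ltW p0).
rewrite -(@ler_pXn2r _ 2) ?nnegrE ?(ltW p0) //.
have := cos_mulr2n (pi / 4 : R).
have -> : (pi / 4) *+ 2 = pi / 2 :> R by rewrite -mulr_natr; field.
rewrite cos_pihalf cos2sin2 exprMn; lra.
Qed.

Lemma avoid_bound_ge_pi (R : realType) n :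
  6 / pi ^+ 2 <= avoid_bound R n.+4.
Proof.
apply: (@le_trans _ _ (3 / 4)); last first.
  apply: (le_trans _ (avoid_bound_le R (isT : (0 < 3 <= n.+4)%N))).
  by rewrite /avoid_bound !exprS !expr0; lra.
have p8 := pi_sqr_ge8 R.
by rewrite ler_pdivrMr; lra.
Qed.

(** * Gaps *)

Section Gaps.
Variable R : realType.
Implicit Types I J : set R.

(** The common point makes the union convex; it is open and bounded, hence an
    open interval with finite endpoints. *)
Lemma density_free_bigcup (F : set (set R)) x :
  (exists I, F I) -> (forall I, F I -> density_free_interval I /\ I x) ->
  density_free_interval (\bigcup_(I in F) I).
Proof.
move=> [I0 FI0] FP; set U := \bigcup_(I in F) I.
have [dfI0 I0x] := FP _ FI0.
have Ux : U x by exists I0.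
have Usub : U `<=` `[6 / pi ^+ 2, 1].
  by move=> y [I /FP[[_ + _] _] Iy]; apply.
have itvU : is_interval U.
  apply/connected_intervalP/bigcup_connected; first by exists x => I /FP[].
  move=> I /FP[[[ab _ ->] _ _] _].
  by apply/connected_intervalP; exact: interval_is_interval.
have opU : open U.
  by apply: bigcup_open => I /FP[[[ab _ ->] _ _] _]; exact: interval_open.
have lbU : has_lbound U.
  by exists (6 / pi ^+ 2) => y /Usub /=; rewrite in_itv => /andP[].
have ubU : has_ubound U.
  by exists 1 => y /Usub /=; rewrite in_itv => /andP[].
have UE : U = `]inf U, sup U[%classic.
  by rewrite -[LHS]((interior_id U).1 opU) interval_bounded_interior.
split=> //.
- exists (inf U, sup U) => //=.
  by move: Ux; rewrite {1}UE /= in_itv /= => /andP[/lt_trans]; apply.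
- rewrite -subset0 => y [[I /FP[[_ _ dfI] _] Iy] dy].
  by rewrite -[set0 y]/(set0 y) -dfI.
Qed.

(** The union of all density-free intervals through a point of [I] is the gap. *)
Lemma sub_gap I : density_free_interval I -> exists2 J, gaps R J & I `<=` J.
Proof.
move=> dfI; have [[[a b] /= ab IE] _ _] := dfI.
pose x := (a + b) / 2.
have Ix : I x by rewrite IE /= in_itv /=; rewrite /x; apply/andP; split; lra.
pose F : set (set R) := [set K | density_free_interval K /\ K x].
exists (\bigcup_(K in F) K); last by move=> y Iy; exists I.
split; first by apply: (@density_free_bigcup _ x) => //; exists I.
move=> J dfJ UJ; apply/seteqP; split=> // y Jy; exists J => //; split=> //.
by apply: UJ; exists I.
Qed.

Lemma gaps_meet_eq I J x : gaps R I -> gaps R J -> I x -> J x -> I = J.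
Proof.
move=> [dfI maxI] [dfJ maxJ] Ix Jx.
have dfU : density_free_interval (\bigcup_(K in [set I; J]) K).
  apply: (@density_free_bigcup _ x); first by exists I; left.
  by move=> K [->|->].
transitivity (\bigcup_(K in [set I; J]) K).
  by apply/esym/maxI => // y Iy; exists I => //; left.
by apply: maxJ => // y Jy; exists J => //; right.
Qed.

Lemma countable_gaps : countable (gaps R).
Proof.
pose q I : rat := xget 0 [set r | I (ratr r)].
have qP I : gaps R I -> I (ratr (q I)).
  move=> [[[[a b] /= ab IE] _ _] _]; apply: (@xgetPex _ 0 [set r | I (ratr r)]).
  by have [r ?] := rat_in_itvoo ab; exists r; rewrite IE.
apply/countable_injP; exists (pickle \o q) => I J.
rewrite !inE => gI gJ /= /(pcan_inj pickleK) qIJ.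
by apply: (gaps_meet_eq gI gJ (qP I gI)); rewrite qIJ; exact: qP.
Qed.

(** * Infinitely many gaps *)

Definition density_hole (n : nat) : set R :=
  `]avoid_bound R n.+1, full_bound R n[%classic.

Lemma density_not_in_hole (S : set nat) n (d : R) :
  has_natural_density (exp_numbers S) d -> ~ density_hole n d.
Proof.
move=> Sd; rewrite /density_hole /= in_itv /= => /andP[ld dh].
have [fullS|] := pselect (forall j, (0 < j < n.+2)%N -> S j).
  by have := full_density_ge fullS Sd; rewrite leNgt dh.
move=> /existsNP[j /not_implyP[/andP[j0 jn] Sj]].
have jn1 : (0 < j <= n.+1)%N by rewrite j0.
have := le_trans (avoid_density_le j0 Sj Sd) (avoid_bound_le R jn1).
by rewrite leNgt ld.
Qed.

Lemma density_free_hole n : (3 <= n)%N -> density_free_interval (density_hole n).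
Proof.
move=> n3; split.
- by exists (avoid_bound R n.+1, full_bound R n) => //; exact: avoid_lt_full.
- move=> x; rewrite /density_hole /= !in_itv /= => /andP[lx xh].
  apply/andP; split.
    by case: n n3 lx {xh} => [|[|[|n]]] // _ /ltW; apply: le_trans; exact: avoid_bound_ge_pi.
  apply/ltW/(lt_le_trans xh); rewrite /full_bound.
  have h2 : 0 <= 2^-1 ^+ n.+2 :> R by rewrite exprn_ge0.
  have h3 : 0 <= 3^-1 ^+ n.+2 :> R by rewrite exprn_ge0.
  have h5 : 0 <= 5^-1 ^+ n :> R by rewrite exprn_ge0.
  lra.
- rewrite -subset0 => d [Id [S _ Sd]].
  by apply: (density_not_in_hole Sd Id).
Qed.

Lemma exponents_below_bigG n : bigG (exponents_below n.+2).
Proof.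
left; exists (iota 2 n).
  exact: (iota_ltn_sorted 1 n.+1).
by apply/seteqP; split=> j;
  rewrite -[exponents_below _ j]/(is_true (1 <= j < 1 + n.+1)%N) -mem_iota.
Qed.

(** The density of the [n.+2]-free numbers is the separating point: their set
    of exponents contains 1, ..., n.+1 but misses [n.+2], and [n.+2 <= k.+1]. *)
Lemma density_between_holes n k : (n < k)%N ->
  exists2 d, densities R d & full_bound R n <= d <= avoid_bound R k.+1.
Proof.
move=> nk; have [d dP] := free_density_exists R n; exists d.
  by exists (exponents_below n.+2) => //; exact: exponents_below_bigG.
apply/andP; split; first by apply: full_density_ge dP.
have nk2 : (0 < n.+2 <= k.+1)%N by [].
apply: le_trans (avoid_bound_le R nk2); apply: avoid_density_le dP => //.
by rewrite /exponents_below /= ltnn.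
Qed.

Lemma infinite_gaps : infinite_set (gaps R).
Proof.
have gapP n : exists J, gaps R J /\ density_hole n.+3 `<=` J.
  by have [J gJ IJ] := sub_gap (density_free_hole (isT : (3 <= n.+3)%N)); exists J.
have [J JP] := choice gapP.
(* If [J n = J k], this interval contains points of both holes, hence also the
   density between them. *)
have neqJ n k : (n < k)%N -> J n <> J k.
  move=> nk JE.
  have [d dd /andP[nd dk]] := density_between_holes (nk : (n.+3 < k.+3)%N).
  have mid m : exists2 x, J m x & avoid_bound R m.+4 < x < full_bound R m.+3.
    have lt_m := avoid_lt_full R (isT : (3 <= m.+3)%N).
    exists ((avoid_bound R m.+4 + full_bound R m.+3) / 2); last by apply/andP; split; lra.
    by apply: (JP m).2; rewrite /density_hole /= in_itv /=; apply/andP; split; lra.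
  have [x Jx /andP[_ xn]] := mid n; have [y Jy /andP[ky _]] := mid k.
  have [[[[ab _ JnE] _ empty] _] _] := JP n.
  have Jd : J n d.
    rewrite JnE; rewrite -JE in Jy; rewrite JnE in Jx Jy.
    apply: (interval_is_interval Jx Jy); apply/andP; split; lra.
  by have : set0 d by rewrite -empty.
apply: (@sub_infinite_set _ (range J)); first by move=> _ [n _ <-]; exact: (JP n).1.
have injJ : {in [set: nat] &, injective J}.
  move=> n k _ _ JE; apply: contrapT => /eqP.
  by rewrite neq_ltn => /orP[/neqJ|/neqJ/nesym]; apply.
rewrite (eq_finite_set (inj_card_eq injJ)); exact: infinite_nat.
Qed.

End Gaps.

Theorem theorem4 (R : realType) :
  countable (gaps R) /\ infinite_set (gaps R).
Proof. by split; [exact: countable_gaps | exact: infinite_gaps]. Qed.
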